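(* Let $q, r, t, u$ be variables (algebraically independent) over $\mathbb{Q}$, and set \[ X = 7 q^{2} + 7 r^{2} + 21 q t - 7 r t + 34 t^{2} - 7 q u - 21 t u + 4 u^{2} + 7 q + 21 r - 7 u + 34 \] and \begin{align*} L &= L(2, 1, 1, 4, 2, 1, 1, -2),\\ R &= R\left(\frac{3(t^2 - 1)u}{2X},\; q,\; r,\; 1,\; t,\; u-q-3t-1,\; t - r - 3,\; \frac{u^2-X}{2u}\right). \end{align*} Then $M=L\cdot R$ is a proper Euler's magic matrix over the rational function field $\mathbb{Q}(q,r,t,u)$.
   Context: Let $S$ be a commutative ring and $n$ a positive integer. A matrix $M=(m_{i,j})_{1\le i,j\le n}\in S^{n\times n}$ is called an Euler's magic matrix over $S$ if there is some $\gamma\in S\setminus\{0\}$ such that (i) $M\cdot M^t=\gamma\cdot I_n$, where $M^t$ is the transpose of $M$ and $I_n$ is the $n\times n$ identity matrix; (ii) $\sum_{i=1}^n m_{i,i}^2=\gamma$; and (iii) $\sum_{i=1}^n m_{i,n+1-i}^2=\gamma$. It is called a proper Euler's magic matrix if in addition the squares of its entries are pairwise distinct, i.e. $m_{i,j}^2\ne m_{k,l}^2$ whenever $(i,j)\ne(k,l)$. The $8\times 8$ matrices $L(\cdot)$ and $R(\cdot)$ are defined by (the letters here are formal arguments) \[L(a,b,c,d,e,f,g,h)= \left(\begin{array}{rrrrrrrr} a & -b & -c & -d & -e & -f & -g & -h \\ b & a & -d & c & -f & e & h & -g \\ c & d & a & -b & -g & -h & e & f \\ d & -c & b & a & -h &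 g & -f & e \\ e & f & g & h & a & -b & -c & -d \\ f & -e & h & -g & b & a & d & -c \\ g & -h & -e & f & c & -d & a & b \\ h & g & -f & -e & d & c & -b & a \end{array}\right) \] and \[R(p,q,r,s,t,u,v,w)= \left(\begin{array}{rrrrrrrr} p & -q & -r & -s & -t & -u & -v & -w \\ q & p & s & -r & u & -t & -w & v \\ r & -s & p & q & v & w & -t & -u \\ s & r & -q & p & w & -v & u & -t \\ t & -u & -v & -w & p & q & r & s \\ u & t & -w & v & -q & p & -s & r \\ v & w & t & -u & -r & s & p & -q \\ w & -v & u & t & -s & -r & q & p \end{array}\right). \] When evaluating $R(\cdot)$ in the claim, the eight arguments are substituted for $p,q,r,s,t,u,v,w$ in this order; in particular the sixth argument $u-q-3t-1$ takes the place of the formal argument $u$ of $R(\cdot)$. *)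

(* Defs.v *)
From mathcomp Require Import all_boot all_algebra.
From mathcomp Require Import mpoly.

Set Implicit Arguments.
Unset Strict Implicit.
Unset Printing Implicit Defensive.

Import GRing.Theory.
Local Open Scope ring_scope.

(* [rev_ord i] is [n - 1 - i], i.e. the 1-based index [n + 1 - i]. For n = 0
   the two diagonal conditions force gamma = 0, so no 0 x 0 matrix qualifies. *)
Definition euler_magic (S : comPzRingType) (n : nat) (M : 'M[S]_n) : Prop :=
  exists gamma : S,
    [/\ gamma != 0,
        M *m M^T = gamma *: 1%:M,
        \sum_(i < n) M i i ^+ 2 = gamma &
        \sum_(i < n) M i (rev_ord i) ^+ 2 = gamma].

Definition proper_euler_magic (S : comPzRingType) (n : nat) (M : 'M[S]_n) : Prop :=
  euler_magic M /\
  forall i j k l : 'I_n, (i, j) != (k, l) -> M i j ^+ 2 != M k l ^+ 2.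

Definition mx_of_rows (S : comPzRingType) (m n : nat) (rows : seq (seq S)) :
    'M[S]_(m, n) :=
  \matrix_(i < m, j < n) (nth [::] rows i)`_j.

Definition Lmx (S : comPzRingType) (a b c d e f g h : S) : 'M[S]_8 :=
  mx_of_rows 8 8
  [:: [:: a; -b; -c; -d; -e; -f; -g; -h];
      [:: b;  a; -d;  c; -f;  e;  h; -g];
      [:: c;  d;  a; -b; -g; -h;  e;  f];
      [:: d; -c;  b;  a; -h;  g; -f;  e];
      [:: e;  f;  g;  h;  a; -b; -c; -d];
      [:: f; -e;  h; -g;  b;  a;  d; -c];
      [:: g; -h; -e;  f;  c; -d;  a;  b];
      [:: h;  g; -f; -e;  d;  c; -b;  a]].

Definition Rmx (S : comPzRingType) (p q r s t u v w : S) : 'M[S]_8 :=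
  mx_of_rows 8 8
  [:: [:: p; -q; -r; -s; -t; -u; -v; -w];
      [:: q;  p;  s; -r;  u; -t; -w;  v];
      [:: r; -s;  p;  q;  v;  w; -t; -u];
      [:: s;  r; -q;  p;  w; -v;  u; -t];
      [:: t; -u; -v; -w;  p;  q;  r;  s];
      [:: u;  t; -w;  v; -q;  p; -s;  r];
      [:: v;  w;  t; -u; -r;  s;  p; -q];
      [:: w; -v;  u;  t; -s; -r;  q;  p]].

Definition ratfun_var (n : nat) (i : 'I_n) : {fraction {mpoly rat[n]}} :=
  tofrac ('X_i : {mpoly rat[n]}).

(* Main.v *)
(* Both L and R have pairwise orthogonal rows of equal norm, so M does too, with
   gamma = 32 (p^2 + ... + w^2) for the arguments p, ..., w of R. For arguments
   of the shape (p, q, r, 1, t, u - q - 3 t - 1, t - r - 3, w), each of the two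
   diagonal conditions is an integer combination of
     2 (u - 2 w) p = 3 (t^2 - 1)   and   X = u^2 - 2 u w,
   which the given values of p and w solve. For the distinctness of the squares
   (and gamma != 0), clear the denominators by the factor 2 X u and evaluate at
   (q, r, t, u) = (-1, -3, -5, -4), where X = 528: up to the factor -384, the
   resulting matrix is an integer one whose entries have distinct absolute
   values. *)
Require Import Defs.
From mathcomp Require Import all_boot all_algebra.
From mathcomp Require Import mpoly.
From mathcomp Require Import ring.

Set Implicit Arguments.
Unset Strict Implicit.
Unset Printing Implicit Defensive.

Import GRing.Theory Num.Theory.
Local Open Scope ring_scope.

(** * Matrices given by lists of rows *)

Lemma map_mx_of_rows (S T : comPzRingType) (f : S -> T) (m n : nat)
    (rows : seq (seq S)) :
  f 0 = 0 -> map_mx f (mx_of_rows m n rows) = mx_of_rows m n (map (map f) rows).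
Proof.
move=> f0; apply/matrixP=> i j; rewrite !mxE.
have -> : nth [::] (map (map f) rows) i = map f (nth [::] rows i).
  case: (ltnP i (size rows)) => si; first by rewrite (nth_map [::]).
  by rewrite !nth_default ?size_map.
(* Entries missing from the lists read as 0 on both sides, hence the condition [f 0 = 0]. *)
case: (ltnP j (size (nth [::] rows i))) => sj; first by rewrite (nth_map 0).
by rewrite !(nth_default 0) ?size_map ?f0.
Qed.

Lemma map_Lmx (S T : comPzRingType) (f : {additive S -> T}) (a b c d e g h k : S) :
  map_mx f (Lmx a b c d e g h k) =
  Lmx (f a) (f b) (f c) (f d) (f e) (f g) (f h) (f k).
Proof. by rewrite map_mx_of_rows ?raddf0 //= !raddfN. Qed.

Lemma map_Rmx (S T : comPzRingType) (f : {additive S -> T}) (a b c d e g h k : S) :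
  map_mx f (Rmx a b c d e g h k) =
  Rmx (f a) (f b) (f c) (f d) (f e) (f g) (f h) (f k).
Proof. by rewrite map_mx_of_rows ?raddf0 //= !raddfN. Qed.

Lemma scale_Rmx (S : comPzRingType) (x a b c d e g h k : S) :
  x *: Rmx a b c d e g h k =
  Rmx (x * a) (x * b) (x * c) (x * d) (x * e) (x * g) (x * h) (x * k).
Proof.
have -> : x *: Rmx a b c d e g h k = map_mx ( *%R x) (Rmx a b c d e g h k).
  by apply/matrixP => i j; rewrite !mxE.
by rewrite map_mx_of_rows ?mulr0 //= !mulrN.
Qed.

(** An eight-square identity in matrix form, checked entry by entry. *)
Lemma Lmx_mul_tr (S : comNzRingType) (a b c d e f g h : S) :
  Lmx a b c d e f g h *m (Lmx a b c d e f g h)^T =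
  (a ^+ 2 + b ^+ 2 + c ^+ 2 + d ^+ 2 + e ^+ 2 + f ^+ 2 + g ^+ 2 + h ^+ 2)%:M.
Proof.
apply/matrixP=> -[i lti] [j ltj]; rewrite !mxE !big_ord_recl big_ord0 !mxE /=.
do 8?[case: i lti => [|i] lti //]; do 8?[case: j ltj => [|j] ltj //];
  rewrite -?val_eqE /= ?mulr1n ?mulr0n; ring.
Qed.

Lemma Rmx_mul_tr (S : comNzRingType) (p q r s t u v w : S) :
  Rmx p q r s t u v w *m (Rmx p q r s t u v w)^T =
  (p ^+ 2 + q ^+ 2 + r ^+ 2 + s ^+ 2 + t ^+ 2 + u ^+ 2 + v ^+ 2 + w ^+ 2)%:M.
Proof.
apply/matrixP=> -[i lti] [j ltj]; rewrite !mxE !big_ord_recl big_ord0 !mxE /=.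
do 8?[case: i lti => [|i] lti //]; do 8?[case: j ltj => [|j] ltj //];
  rewrite -?val_eqE /= ?mulr1n ?mulr0n; ring.
Qed.

Lemma mul_mx_of_rowsE (S : comPzRingType) (m n p : nat) (A B : seq (seq S))
    (i : 'I_m) (j : 'I_p) :
  (mx_of_rows m n A *m mx_of_rows n p B) i j =
  \sum_(0 <= k < n) (nth [::] A i)`_k * (nth [::] B k)`_j.
Proof. by rewrite mxE big_mkord; apply: eq_bigr => k _; rewrite !mxE. Qed.

(** * Gram and diagonal identities with [p] and [w] free *)

Definition quadX (S : comNzRingType) (q r t u : S) : S :=
  7 * q ^+ 2 + 7 * r ^+ 2 + 21 * q * t - 7 * r * t + 34 * t ^+ 2
  - 7 * q * u - 21 * t * u + 4 * u ^+ 2 + 7 * q + 21 * r - 7 * u + 34.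

Lemma rmorph_quadX (S T : comNzRingType) (f : {rmorphism S -> T}) (q r t u : S) :
  f (quadX q r t u) = quadX (f q) (f r) (f t) (f u).
Proof. by rewrite /quadX !(rmorph_nat, rmorphD, rmorphN, rmorphM, rmorphXn). Qed.

Section Family.
Variables (S : comNzRingType) (p q r t u w : S).

Let X := quadX q r t u.
Let M := Lmx (2 : S) 1 1 4 2 1 1 (- 2) *m
         Rmx p q r 1 t (u - q - 3 * t - 1) (t - r - 3) w.
(** [E1] and [E2] measure the failure of the two relations that determine [p] and [w]. Keeping [p]
    and [w] free avoids division, so the diagonal sums become polynomial identities with an explicit
    error. *)
Let E1 : S := 2 * (u - 2 * w) * p - 3 * (t ^+ 2 - 1).
Let E2 : S := X - (u ^+ 2 - 2 * u * w).
Let gamma : S := 32 * (p ^+ 2 + q ^+ 2 + r ^+ 2 + 1 + t ^+ 2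
   + (u - q - 3 * t - 1) ^+ 2 + (t - r - 3) ^+ 2 + w ^+ 2).

(** Regrouping as L (R R^T) L^T leaves two scalar matrices; 32 is the sum of the squares of 2, 1, 1,
    4, 2, 1, 1, -2. *)
Lemma family_gram : M *m M^T = gamma *: 1%:M.
Proof.
rewrite trmx_mul mulmxA -(mulmxA (Lmx _ _ _ _ _ _ _ _)) Rmx_mul_tr mul_mx_scalar.
rewrite -scalemxAl Lmx_mul_tr !scale_scalar_mx /gamma; congr (_%:M); ring.
Qed.

Lemma family_diag : \sum_(i < 8) M i i ^+ 2 = gamma + 8 * (E1 - E2).
Proof.
under eq_bigr do rewrite mul_mx_of_rowsE.
(* Over a range of naturals the sums compute once unlocked, which leaves an identity for [ring]. *)
rewrite -(big_mkord xpredT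
  (fun i => (\sum_(0 <= k < 8) (nth [::] _ i)`_k * (nth [::] _ k)`_i) ^+ 2)).
rewrite unlock /= /gamma /E1 /E2 /X /quadX; ring.
Qed.

Lemma family_antidiag :
  \sum_(i < 8) M i (rev_ord i) ^+ 2 = gamma - 8 * (E1 + E2).
Proof.
under eq_bigr do rewrite mul_mx_of_rowsE.
(* Here [8 - i.+1] is the value of [rev_ord i]. *)
rewrite -(big_mkord xpredT (fun i =>
  (\sum_(0 <= k < 8) (nth [::] _ i)`_k * (nth [::] _ k)`_(8 - i.+1)) ^+ 2)).
rewrite unlock /= /gamma /E1 /E2 /X /quadX; ring.
Qed.
End Family.

(** * The specialized integer matrix and the cleared denominators *)

Lemma specialized_sqr_neq (i j k l : 'I_8) : (i, j) != (k, l) ->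
  let N := Lmx (2 : int) 1 1 4 2 1 1 (- 2)
           *m Rmx (- 3) (- 11) (- 33) 11 (- 55) 121 (- 55) 704 in
  N i j ^+ 2 != N k l ^+ 2.
Proof.
move=> ijkl; rewrite /Lmx /Rmx /=.
set A := (X in mx_of_rows 8 8 X *m _); set B := (X in _ *m mx_of_rows 8 8 X).
rewrite !mul_mx_of_rowsE.
(* Integers with equal squares have equal absolute values, so a finite check over pairs of the 64
   positions in [s] suffices. *)
pose f (x : nat * nat) :=
  absz (\sum_(0 <= m < 8) (nth [::] A x.1)`_m * (nth [::] B m)`_x.2).
pose s := [seq (x, y) | x <- iota 0 8, y <- iota 0 8].
have : all2rel (fun x y => (x == y) || (f x != f y)) s.
  by rewrite /f unlock; vm_compute.
have s_in (x y : 'I_8) : (val x, val y) \in s by apply: allpairs_f; rewrite mem_iota /=.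
move=> /allrelP /(_ _ _ (s_in i j) (s_in k l)) /orP[/eqP[] /val_inj ik /val_inj jl|].
  by rewrite ik jl eqxx in ijkl.
apply: contraNneq => /eqP; rewrite eqf_sqr /f /= => /orP[]/eqP -> //.
by rewrite abszN.
Qed.

(** This is 2 X u M, written without division so that it makes sense over any ring and commutes with
    ring morphisms. *)
Definition clearedM (S : comNzRingType) (q r t u : S) : 'M[S]_8 :=
  let X := quadX q r t u in
  Lmx (2 : S) 1 1 4 2 1 1 (- 2) *m
  Rmx (3 * (t ^+ 2 - 1) * u ^+ 2) (2 * X * u * q) (2 * X * u * r) (2 * X * u)
      (2 * X * u * t) (2 * X * u * (u - q - 3 * t - 1)) (2 * X * u * (t - r - 3))
      ((u ^+ 2 - X) * X).

Lemma map_clearedM (S T : comNzRingType) (f : {rmorphism S -> T}) (q r t u : S) :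
  map_mx f (clearedM q r t u) = clearedM (f q) (f r) (f t) (f u).
Proof.
rewrite map_mxM map_Lmx map_Rmx.
by rewrite /= !(rmorph_nat, rmorph_quadX, rmorph1, rmorphD, rmorphN, rmorphM, rmorphXn).
Qed.

Lemma clearedME (F : fieldType) (q r t u : F) :
  2 != 0 :> F -> u != 0 -> quadX q r t u != 0 ->
  let X := quadX q r t u in
  (2 * X * u) *: (Lmx (2 : F) 1 1 4 2 1 1 (- 2) *m
    Rmx (3 * (t ^+ 2 - 1) * u / (2 * X)) q r 1 t
        (u - q - 3 * t - 1) (t - r - 3) ((u ^+ 2 - X) / (2 * u))) =
  clearedM q r t u.
Proof.
rewrite /clearedM; move: (quadX q r t u) => X n2 nu nX /=.
rewrite scalemxAr scale_Rmx mulr1; congr (_ *m Rmx _ _ _ _ _ _ _ _); field.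
  by rewrite nX.
by rewrite nu.
Qed.

(* Stands in for [congr], which tries to identify rational constants by
   conversion and overflows the stack. *)
Lemma Rmx_eq (S : comPzRingType) (p q r s t u v w p' q' r' s' t' u' v' w' : S) :
  p = p' -> q = q' -> r = r' -> s = s' -> t = t' -> u = u' -> v = v' -> w = w' ->
  Rmx p q r s t u v w = Rmx p' q' r' s' t' u' v' w'.
Proof. by do 8!move->. Qed.

Lemma quadX_specialize : quadX (-1) (-3) (-5) (-4) = 528 :> rat.
Proof. by rewrite /quadX; ring. Qed.

(** At this point 2 X u = -4224 = -384 * 11, while the first and last arguments of [Rmx] are 1152 =
    -384 * -3 and -270336 = -384 * 704. *)
Lemma clearedM_specialize :
  clearedM (-1) (-3) (-5) (-4) =
  (- 384) *: map_mx intr (Lmx (2 : int) 1 1 4 2 1 1 (- 2)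
           *m Rmx (- 3) (- 11) (- 33) 11 (- 55) 121 (- 55) 704) :> 'M[rat]_8.
Proof.
rewrite map_mxM map_Lmx map_Rmx scalemxAr scale_Rmx /clearedM quadX_specialize.
apply: (congr2 mulmx); first by rewrite /= rmorphN rmorph1 !rmorph_nat.
by apply: Rmx_eq; rewrite /= ?rmorphN ?rmorph1 ?rmorph_nat; ring.
Qed.

(** * Transfer from a specialization to the field *)

Lemma sqr_neq_specialize (F : fieldType) (A : comNzRingType)
    (f : {rmorphism A -> F}) (e : {rmorphism A -> rat}) (m : nat) (d : F)
    (M : 'M[F]_m) (P : 'M[A]_m) (c : rat) (N : 'M[int]_m) (i j k l : 'I_m) :
    injective f -> c != 0 -> d *: M = map_mx f P ->
    map_mx e P = c *: map_mx intr N ->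
  N i j ^+ 2 != N k l ^+ 2 -> M i j ^+ 2 != M k l ^+ 2.
Proof.
move=> f_inj c0 MP PN; apply: contraNneq => Mijkl.
have MPE x y : d * M x y = f (P x y) by move/matrixP: MP => /(_ x y); rewrite !mxE.
have PNE x y : e (P x y) = c * (N x y)%:~R.
  by move/matrixP: PN => /(_ x y); rewrite !mxE.
(* Scaled by d^2, an equality of squares lies in the image of [f]; it pulls back to [A], and after
   [e] the factor c^2 cancels. *)
have /f_inj/(congr1 e) : f (P i j ^+ 2) = f (P k l ^+ 2).
  by rewrite !rmorphXn /= -!MPE !exprMn Mijkl.
rewrite !rmorphXn /= !PNE !exprMn => /(mulfI (expf_neq0 2 c0)) /eqP.
by rewrite -!rmorphXn /= eqr_int.
Qed.

Lemma specialize_neq0 (A F T : pzRingType)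
    (f : {rmorphism A -> F}) (e : {rmorphism A -> T}) (x : A) :
  injective f -> e x != 0 -> f x != 0.
Proof.
move=> f_inj; apply: contraNneq => fx0.
have /f_inj -> : f x = f 0 by rewrite fx0 rmorph0.
by rewrite rmorph0.
Qed.

(* If gamma = 0, a row of the specialized matrix is a rational vector of norm 0. *)
Lemma gram_neq0_specialize (F : fieldType) (A : comNzRingType)
    (f : {rmorphism A -> F}) (e : {rmorphism A -> rat}) (m : nat) (d gamma : F)
    (M : 'M[F]_m) (P : 'M[A]_m) (i j : 'I_m) :
    injective f -> d *: M = map_mx f P -> M *m M^T = gamma *: 1%:M ->
  e (P i j) != 0 -> gamma != 0.
Proof.
move=> f_inj MP MM; apply: contraNneq => gamma0.
have fPP : map_mx f (P *m P^T) = 0.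
  rewrite map_mxM -matrix.map_trmx -MP linearZ /= -scalemxAl -scalemxAr MM.
  by rewrite gamma0 scale0r !scaler0.
have ePP : e ((P *m P^T) i i) = 0.
  have /f_inj -> : f ((P *m P^T) i i) = f 0; last by rewrite rmorph0.
  by move/matrixP: fPP => /(_ i i); rewrite !mxE rmorph0.
have sqrE k : e (P i k * P^T k i) = e (P i k) ^+ 2 by rewrite mxE rmorphM expr2.
move: ePP; rewrite mxE rmorph_sum /= (eq_bigr _ (fun k _ => sqrE k)).
move=> /psumr_eq0P /(_ j isT) ePj.
by rewrite -sqrf_eq0 ePj // => k _; apply: sqr_ge0.
Qed.

Lemma denominators_relations (F : fieldType) (t u X : F) :
    2 != 0 :> F -> u != 0 -> X != 0 ->
    let p := 3 * (t ^+ 2 - 1) * u / (2 * X) in let w := (u ^+ 2 - X) / (2 * u) in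
  2 * (u - 2 * w) * p - 3 * (t ^+ 2 - 1) = 0 /\ X - (u ^+ 2 - 2 * u * w) = 0.
Proof. by move=> n2 nu nX /=; split; field; rewrite ?nX nu n2. Qed.

Section Specialization.
Variables (F : fieldType) (A : comNzRingType).
Variables (f : {rmorphism A -> F}) (e : {rmorphism A -> rat}).
Hypothesis f_inj : injective f.
Variables (q0 r0 t0 u0 : A).
Hypotheses (eq0 : e q0 = -1) (er0 : e r0 = -3) (et0 : e t0 = -5) (eu0 : e u0 = -4).

(** [A] stands for the polynomial ring, [f] for its embedding into the fraction field and [e] for
    evaluation at the rational point. *)
Lemma proper_euler_magic_of_specialization :
  let q := f q0 in let r := f r0 in let t := f t0 in let u := f u0 in
  let X := quadX q r t u in
  proper_euler_magic (Lmx (2 : F) 1 1 4 2 1 1 (- 2) *m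
    Rmx (3 * (t ^+ 2 - 1) * u / (2 * X)) q r 1 t
        (u - q - 3 * t - 1) (t - r - 3) ((u ^+ 2 - X) / (2 * u))).
Proof.
move=> q r t u X.
(* The elements 2, u and X are nonzero because [e] gives 2, -4 and 528. *)
have n2 : 2 != 0 :> F.
  by rewrite -(rmorph_nat f); apply: (specialize_neq0 (e := e)); rewrite ?rmorph_nat.
have nu : u != 0 by apply: (specialize_neq0 (e := e)); rewrite ?eu0.
have nX : X != 0.
  rewrite /X -rmorph_quadX; apply: (specialize_neq0 (e := e)) => //.
  by rewrite rmorph_quadX eq0 er0 et0 eu0 quadX_specialize pnatr_eq0.
have ME := clearedME n2 nu nX; rewrite /= -/X in ME.
rewrite -map_clearedM in ME.
set M := _ *m _ in ME *.
have c0 : - 384 != 0 :> rat by rewrite oppr_eq0 pnatr_eq0.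
have eP : map_mx e (clearedM q0 r0 t0 u0) = clearedM (-1) (-3) (-5) (-4).
  by rewrite map_clearedM /= eq0 er0 et0 eu0.
have dist i j k l : (i, j) != (k, l) -> M i j ^+ 2 != M k l ^+ 2.
  move=> /specialized_sqr_neq; apply: (sqr_neq_specialize f_inj c0 ME).
  exact: etrans eP clearedM_specialize.
split; last exact: dist.
have [E1 E2] := denominators_relations t n2 nu nX.
exists (32 * ((3 * (t ^+ 2 - 1) * u / (2 * X)) ^+ 2 + q ^+ 2 + r ^+ 2 + 1 + t ^+ 2
   + (u - q - 3 * t - 1) ^+ 2 + (t - r - 3) ^+ 2 + ((u ^+ 2 - X) / (2 * u)) ^+ 2)).
split.
(* The top left entry of the integer matrix is 1446, so its row is nonzero. *)
- apply: (gram_neq0_specialize (e := e) (i := ord0) (j := ord0) f_inj ME).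
    exact: family_gram.
  move/matrixP: eP => /(_ ord0 ord0); rewrite mxE => ->.
  rewrite clearedM_specialize mxE [X in _ * X]mxE mulf_eq0 (negPf c0) intr_eq0 /=.
  by rewrite mul_mx_of_rowsE unlock.
- exact: family_gram.
- by rewrite family_diag E1 E2 subr0 mulr0 addr0.
- by rewrite family_antidiag E1 E2 addr0 mulr0 subr0.
Qed.
End Specialization.

Theorem theorem1p4 :
  let q : {fraction {mpoly rat[4]}} := ratfun_var (@Ordinal 4 0 isT) in
  let r : {fraction {mpoly rat[4]}} := ratfun_var (@Ordinal 4 1 isT) in
  let t : {fraction {mpoly rat[4]}} := ratfun_var (@Ordinal 4 2 isT) in
  let u : {fraction {mpoly rat[4]}} := ratfun_var (@Ordinal 4 3 isT) in
  let X := 7 * q ^+ 2 + 7 * r ^+ 2 + 21 * q * t - 7 * r * t + 34 * t ^+ 2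
           - 7 * q * u - 21 * t * u + 4 * u ^+ 2 + 7 * q + 21 * r - 7 * u + 34 in
  let L := Lmx (2 : {fraction {mpoly rat[4]}}) 1 1 4 2 1 1 (- 2) in
  let R := Rmx (3 * (t ^+ 2 - 1) * u / (2 * X)) q r 1 t
               (u - q - 3 * t - 1) (t - r - 3) ((u ^+ 2 - X) / (2 * u)) in
  proper_euler_magic (L *m R).
Proof.
(* The evaluation point, in the order q, r, t, u. *)
pose v (i : 'I_4) : rat := [:: -1; -3; -5; -4]`_i.
apply: (proper_euler_magic_of_specialization
  (f := @tofrac {mpoly rat[4]}) (e := meval v)).
  by move=> x y /eqP; rewrite tofrac_eq => /eqP.
all: exact: mevalXU.
Qed.
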